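(* Let $S=K[x_1,\ldots,x_n]$ be a polynomial ring over a field $K$, and let $I=B_1(u_1,\ldots,u_m)\subset S$ be an equigenerated squarefree Borel ideal. Then for any $k\ge1$: (a) $\operatorname{HS}_k(I)=B_1(x_{p_{11}}\cdots x_{p_{1k}}u_1,\ldots,x_{p_{m1}}\cdots x_{p_{mk}}u_m)$, where $p_{i1},\ldots,p_{ik}$ are the maximal possible distinct integers in $\operatorname{gap}(u_i)$. (b) $\operatorname{HS}_1(\operatorname{HS}_k(I))=\operatorname{HS}_{k+1}(I)$.
   Context: $\operatorname{supp}(u)=\{i:x_i\mid u\}$. A squarefree monomial ideal $I$ (one generated by squarefree monomials) is a squarefree Borel ideal (also called $1$-Borel) if for every squarefree monomial $u\in I$, every $j\in\operatorname{supp}(u)$ and every $i<j$ one has $x_i(u/x_j)\in I$, provided $x_i(u/x_j)$ is squarefree. For squarefree monomials $v_1,\ldots,v_r$, $B_1(v_1,\ldots,v_r)$ is the smallest squarefree Borel ideal containing $v_1,\ldots,v_r$; these monomials are called its Borel generators. A monomial ideal is equigenerated if all its minimal monomial generators have the same degree. For a squarefree monomial $u$, $\operatorname{gap}(u)$ is the set of gaps of $u$, i.e. of positive integers $i<\max(\operatorname{supp}(u))$ such that $x_i$ does not divide $u$. For a monomial ideal $I\subset S$ with minimal $\mathbb Z^n$-graded free $S$-resolution $\mathbb F$ of $I$, $F_i=\bigoplus_{j=1}^{b_i}S(-\mathbf a_{ij})$, the $i$th homological shift ideal of $I$ is $\operatorname{HS}_i(I)=(\mathbf x^{\mathbf a_{ij}}: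 j=1,\ldots,b_i)$; in particular $\operatorname{HS}_0(I)=I$.
   Formalization: Each u_i is assumed to be a minimal monomial generator of I (otherwise false: B_1(x_1, x_1x_3) = (x_1) has HS_1 = 0, but the formula gives x_1x_2x_3), and in (a) any u_i with fewer than k gaps, for which the p_{ij} do not exist, contributes no generator. *)

(* Defs.v *)
From HB Require Import structures.
From mathcomp Require Import all_boot all_order all_algebra.
From mathcomp Require Export mpoly.

Set Implicit Arguments.
Unset Strict Implicit.
Unset Printing Implicit Defensive.

Import GRing.Theory.
Local Open Scope ring_scope.

(* The variables x_1, ..., x_n are indexed by 'I_n, so the ordinal i stands for
   the paper's index i.+1; monomials are exponent vectors in 'X_{1..n}. *)

Section Monomials.
Variable n : nat.
Implicit Types u : 'X_{1..n}.

Definition supp u : {set 'I_n} := [set i | (0 < u i)%N].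

Definition sqfree u : bool := [forall i, (u i <= 1)%N].

(* max (supp u) as a 1-based index, and 0 if u = 1. *)
Definition max_supp u : nat := \max_(i in supp u) i.+1.

Definition gap u : {set 'I_n} :=
  [set i : 'I_n | (i.+1 < max_supp u)%N && (i \notin supp u)].

(* The k largest elements of gap u (all of gap u if it has at most k). *)
Definition max_gaps (k : nat) u : {set 'I_n} :=
  [set i in gap u | (#|[set j in gap u | (i < j)%N]| < k)%N].

Definition mul_max_gaps (k : nat) u : 'X_{1..n} :=
  (u + \sum_(i in max_gaps k u) U_(i))%MM.

End Monomials.

Section Ideals.
Variables (K : fieldType) (n : nat).
Local Notation S := {mpoly K[n]}.
Implicit Types (I J : S -> Prop) (M : 'X_{1..n} -> Prop).

Definition mideal M : S -> Prop := fun f =>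
  exists s : seq (S * 'X_{1..n}),
    (forall p, p \in s -> M p.2) /\ f = \sum_(p <- s) p.1 * 'X_[p.2].

Definition mingen I (u : 'X_{1..n}) : Prop :=
  I 'X_[u] /\ forall v : 'X_{1..n}, I 'X_[v] -> (v <= u)%MM -> v = u.

Definition equigenerated I : Prop :=
  exists d : nat, forall u, mingen I u -> mdeg u = d.

Definition sqfree_monomial_ideal I : Prop :=
  exists M, (forall u, M u -> sqfree u) /\ (forall f, I f <-> mideal M f).

Definition sqfree_borel I : Prop :=
  sqfree_monomial_ideal I /\
  forall (u : 'X_{1..n}) (i j : 'I_n),
    sqfree u -> I 'X_[u] -> j \in supp u -> (i < j)%N ->
    sqfree (u - U_(j) + U_(i))%MM -> I 'X_[(u - U_(j) + U_(i))%MM].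

(* Squarefree Borel ideals are closed under arbitrary intersections, so the
   smallest one containing vs is the intersection of all of them. *)
Definition B1 (vs : seq 'X_{1..n}) : S -> Prop := fun f =>
  forall J, sqfree_borel J -> (forall v, v \in vs -> J 'X_[v]) -> J f.

End Ideals.

Section Resolutions.
Variables (K : fieldType) (n : nat).
Local Notation S := {mpoly K[n]}.

(* Data of a sequence ... -> F_1 -> F_0 -> S, where F_i is the direct sum over
   j < rk i of S(- shift i j).  An element of F_i is a row vector, and maps act
   by right multiplication.  Shifts are taken in N^n: this is no restriction
   for minimal resolutions of ideals of S. *)
Record free_seq := FreeSeq {
  rk : nat -> nat;
  shift : forall i, 'I_(rk i) -> 'X_{1..n};
  aug : 'cV[S]_(rk 0);
  diff : forall i, 'M[S]_(rk i.+1, rk i)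
}.

(* aug and diff have multidegree 0: the (j, l) entry of diff i is a scalar
   multiple of the monomial of exponent shift i.+1 j - shift i l. *)
Definition multigraded (F : free_seq) : Prop :=
  (forall (j : 'I_(rk F 0)) (m : 'X_{1..n}),
      m \in msupp (aug F j 0) -> m = shift j) /\
  (forall i (j : 'I_(rk F i.+1)) (l : 'I_(rk F i)) (m : 'X_{1..n}),
      m \in msupp (diff F i j l) -> (m + shift l)%MM = shift j).

Definition resolves (F : free_seq) (I : S -> Prop) : Prop :=
  [/\ forall f, I f <-> exists v : 'rV[S]_(rk F 0), f = (v *m aug F) 0 0,
      forall v : 'rV[S]_(rk F 0),
        v *m aug F = 0 <-> exists w : 'rV[S]_(rk F 1), v = w *m diff F 0
    & forall i (v : 'rV[S]_(rk F i.+1)),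
        v *m diff F i = 0 <->
        exists w : 'rV[S]_(rk F i.+2), v = w *m diff F i.+1].

(* The image of each differential lies in (x_1, ..., x_n) F_i. *)
Definition minimal (F : free_seq) : Prop :=
  forall i (j : 'I_(rk F i.+1)) (l : 'I_(rk F i)), (diff F i j l)@_0%MM = 0.

Definition min_resolution (I : S -> Prop) (F : free_seq) : Prop :=
  [/\ multigraded F, resolves F I & minimal F].

(* The minimal multigraded free resolution is unique up to isomorphism, hence
   so is its family of shifts; quantifying over all representatives F only
   avoids choosing one of them. *)
Definition HS (k : nat) (I : S -> Prop) : S -> Prop :=
  mideal (fun a => exists F, min_resolution I F /\
                   exists j : 'I_(rk F k), a = shift j).

End Resolutions.

(* Main.v *)
Require Import Defs.
From mathcomp Require Import all_boot all_order all_algebra.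
From Stdlib Require Import ClassicalEpsilon.

(** Let I be generated in degree d by the squarefree monomials x_A, for A in a
    family G of d-subsets of the set of variables that is stable under Borel
    moves, and write gap A for the gaps of x_A.

    Listed by increasing sum of the indices of their variables, the generators
    of I have linear quotients: the colon of the ideal of the previous
    generators by x_A is generated by the variables in gap A
    ([borel_linear_quotients]).  Adjoining the generators one by one, each step
    being the mapping cone of a lift of multiplication by x_A from a shifted
    Koszul complex to the resolution already built ([cone],
    [koszul_resolution], [linear_quotients]), gives a multigraded free
    resolution whose shifts in degree k are the multidegrees of the x_A x_t with
    t contained in gap A and #|t| = k.  They all have total degree d + k, so
    this resolution is minimal for degree reasons ([linear_minimal]).  Two
    minimal resolutions of the same ideal have the same shifts
    ([min_resolution_shift]); hence HS_k(I) is generated by the x_A x_t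
    ([HS_borel]).

    It remains to compare this ideal with the Borel ideal of the statement.  On
    the one hand the sets A :|: t form a family stable under Borel moves
    ([with_gaps_closed]).  On the other hand, let J be a Borel ideal containing
    u_i times its k last gaps, for all u_i with at least k gaps.  By exchanging
    gaps J contains u_i times any k of its gaps ([gap_full_topk]), and the property of a generator
    that all its products with k gaps are in J is stable under Borel moves
    ([gap_full_closed]), so that it passes from the u_i to all generators of I.
    This proves the formula for HS_k(I), and the one for HS_1(HS_k(I)) follows
    by applying it twice: u_i times its k last gaps has the remaining gaps of
    u_i as its gaps, the largest of which is the next gap of u_i to be added
    ([mul_max_gaps_add1]). *)

Set Implicit Arguments.
Unset Strict Implicit.
Unset Printing Implicit Defensive.

Import GRing.Theory.
Local Open Scope ring_scope.

(** * Multigraded matrices and complexes *)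

(** Dependent choice with a prescribed start; the invariant [P] carries what is
    needed to continue. *)
Lemma dependent_choice (T : nat -> Type) (P : forall i, T i -> Prop)
    (R : forall i, T i -> T i.+1 -> Prop) (x0 : T 0%N) :
    P 0%N x0 ->
    (forall i x, P i x -> exists2 y, P i.+1 y & R i x y) ->
  exists f : forall i, T i,
    [/\ f 0%N = x0, forall i, P i (f i) & forall i, R i (f i) (f i.+1)].
Proof.
move=> P0 step.
have next i (x : {x : T i | P i x}) : {y | P i.+1 y /\ R i (sval x) y}.
  apply: constructive_indefinite_description.
  by have [y Py Ry] := step i _ (svalP x); exists y.
pose fix g i : {x : T i | P i x} :=
  if i is i'.+1 then
    let y := next i' (g i') in exist (P i'.+1) (sval y) (proj1 (svalP y))
  else exist (P 0%N) x0 P0.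
exists (fun i => sval (g i)); split=> // i; first exact: (svalP (g i)).
exact: (proj2 (svalP (next i (g i)))).
Qed.

Section Graded.
Variables (K : fieldType) (n : nat).
Local Notation S := {mpoly K[n]}.

(** [A] represents a map of multidegree 0 between free modules with shifts [sp]
    and [sq]; as everywhere, matrices act on row vectors from the right. *)
Definition graded p q (sp : 'I_p -> 'X_{1..n}) (sq : 'I_q -> 'X_{1..n})
    (A : 'M[S]_(p, q)) : Prop :=
  forall j l m, m \in msupp (A j l) -> (m + sq l)%MM = sp j.

Lemma gradedM p q r sp sq sr (A : 'M[S]_(p, q)) (B : 'M[S]_(q, r)) :
  graded sp sq A -> graded sq sr B -> graded sp sr (A *m B).
Proof.
move=> hA hB j t m; rewrite mxE => /msupp_sum_le/flatten_mapP[l _].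
move=> /msuppM_le/allpairsP[[m1 m2] /= [m1A m2B ->]].
by rewrite -addmA (hB l t) // (hA j l).
Qed.

(** The multidegree 0 component of a matrix [A]. *)
Definition graded_part p q (sp : 'I_p -> 'X_{1..n}) (sq : 'I_q -> 'X_{1..n})
    (A : 'M[S]_(p, q)) : 'M[S]_(p, q) :=
  \matrix_(j, l)
    \sum_(m <- msupp (A j l) | (m + sq l)%MM == sp j) (A j l)@_m *: 'X_[m].

Lemma mcoeff_graded_part p q sp sq (A : 'M[S]_(p, q)) j l m :
  (graded_part sp sq A j l)@_m = (A j l)@_m *+ ((m + sq l)%MM == sp j).
Proof.
rewrite mxE raddf_sum /=.
under eq_bigr do rewrite mcoeffZ mcoeffX.
have [mA|mNA] := boolP (m \in msupp (A j l)); last first.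
  rewrite (memN_msupp_eq0 mNA) mul0rn big1_seq // => m' /andP[_ m'A].
  case: eqVneq => [mm'|_]; last by rewrite mulr0.
  by rewrite -mm' m'A in mNA.
rewrite big_mkcond (bigD1_seq m) ?msupp_uniq //= big1 ?addr0 => [|m' /negPf m'm].
  by case: eqP => _; rewrite ?eqxx ?mulr1.
by rewrite m'm mulr0 if_same.
Qed.

Lemma graded_partP p q sp sq (A : 'M[S]_(p, q)) :
  graded sp sq (graded_part sp sq A).
Proof.
move=> j l m; rewrite mcoeff_msupp mcoeff_graded_part.
by case: (_ =P sp j) => // _; rewrite mulr0n eqxx.
Qed.

(** If [Y] lifts a matrix of multidegree 0, so does its multidegree 0 component. *)
Lemma graded_part_mulmx p q r sp sq sr (Y : 'M[S]_(p, q)) (D : 'M[S]_(q, r)) :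
  graded sq sr D -> graded sp sr (Y *m D) -> graded_part sp sq Y *m D = Y *m D.
Proof.
move=> hD hYD; apply/matrixP=> j t; apply/mpolyP=> m.
have hY'D := gradedM (@graded_partP _ _ sp sq Y) hD.
have [smt|smt] := eqVneq (m + sr t)%MM (sp j); last first.
  have z (B : 'M[S]_(p, r)) : graded sp sr B -> (B j t)@_m = 0.
    by move=> hB; apply/memN_msupp_eq0/negP=> /hB/eqP; rewrite (negPf smt).
  by rewrite !z.
rewrite !mxE !raddf_sum /=; apply: eq_bigr => l _.
rewrite !mcoeffM; apply: eq_bigr => -[k1 k2] /= /eqP mk.
rewrite mcoeff_graded_part; case: eqP => // k1l.
have [/hD k2D|] := boolP (bmnm k2 \in msupp (D l t)).
  by case: k1l; rewrite -smt -k2D addmA -mk.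
by move/memN_msupp_eq0->; rewrite !mulr0.
Qed.

(** Ranks, shifts and differentials of the complex [F] augmented by S: the term
    of degree 0 is S with shift 0, and F_i becomes the term of degree [i.+1].
    The augmentation is then the first differential. *)
Definition arank (F : free_seq K n) i := if i is i'.+1 then rk F i' else 1%N.

Definition ashift (F : free_seq K n) i : 'I_(arank F i) -> 'X_{1..n} :=
  if i is i'.+1 then @shift K n F i' else fun=> 0%MM.

Definition adiff (F : free_seq K n) i : 'M[S]_(arank F i.+1, arank F i) :=
  if i is i'.+1 then @diff K n F i' else aug F.

(** Exactness of the augmented complex except at S, where the cokernel is the
    quotient of S by the ideal that is resolved. *)
Definition acyclic (F : free_seq K n) : Prop :=
  forall i (v : 'rV[S]_(arank F i.+1)),
    v *m adiff F i = 0 <->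
    exists w : 'rV[S]_(arank F i.+2), v = w *m adiff F i.+1.

(** [multigraded], stated on the augmented complex. *)
Definition amultigraded (F : free_seq K n) : Prop :=
  forall i, graded (@ashift F i.+1) (@ashift F i) (adiff F i).

Lemma multigradedE (F : free_seq K n) : multigraded F <-> amultigraded F.
Proof.
split=> [[h0 h] [|i] j l m /= mj|h].
- by rewrite ord1 addm0 in mj *; apply: h0.
- exact: h mj.
split=> [j m mj|i]; last exact: (h i.+1).
by rewrite -[RHS](h 0%N j 0 m mj) /= addm0.
Qed.

Lemma resolvesE (F : free_seq K n) (I : S -> Prop) :
  resolves F I <->
  (forall f, I f <-> exists v : 'rV[S]_(rk F 0), f = (v *m aug F) 0 0) /\
  acyclic F.
Proof.
split=> [[h0 h1 h]|[h0 h]].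
  by split=> //; case=> [|i]; [exact: h1 | exact: h].
by split=> //; [exact: (h 0%N) | move=> i; exact: (h i.+1)].
Qed.

Lemma acyclic_comp F : acyclic F -> forall i, adiff F i.+1 *m adiff F i = 0.
Proof.
move=> acF i; apply/row_matrixP=> j; rewrite row0 row_mul.
by apply/acF; exists (delta_mx 0 j); rewrite -rowE.
Qed.

(** A matrix whose composite with the differential vanishes factors through the
    next one, row by row. *)
Lemma acyclic_lift F i p (X : 'M[S]_(p, arank F i.+1)) :
    acyclic F -> X *m adiff F i = 0 ->
  exists Y : 'M[S]_(p, arank F i.+2), X = Y *m adiff F i.+1.
Proof.
move=> acF X0.
have ex j : exists w, row j X = w *m adiff F i.+1.
  by apply/acF; rewrite -row_mul X0 row0.
pose w j := proj1_sig (constructive_indefinite_description _ (ex j)).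
exists (\matrix_j w j); apply/row_matrixP=> j; rewrite row_mul rowK.
exact: proj2_sig (constructive_indefinite_description _ (ex j)).
Qed.

(** Comparison: a matrix [phi0] in degree 0, shifting multidegrees by [u], extends
    to a multigraded chain map from [C] to the acyclic complex [A] as soon as the
    image of the first differential of [C] is carried into that of [A].  Any lift
    can be replaced by its component of the right multidegree. *)
Lemma chain_map (A C : free_seq K n) (u : 'X_{1..n})
    (phi0 : 'M[S]_(arank C 0, arank A 0)) :
    acyclic A -> amultigraded A -> amultigraded C ->
    (forall i, adiff C i.+1 *m adiff C i = 0) ->
    graded (fun j => (u + @ashift C 0 j)%MM) (@ashift A 0) phi0 ->
    (exists Y, adiff C 0 *m phi0 = Y *m adiff A 0) ->
  exists phi : forall i, 'M[S]_(arank C i, arank A i),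
    [/\ phi 0%N = phi0,
        forall i, graded (fun j => (u + @ashift C i j)%MM) (@ashift A i) (phi i)
      & forall i, adiff C i *m phi i = phi i.+1 *m adiff A i].
Proof.
move=> acA grA grC ddC gr0 ex0.
pose su i (j : 'I_(arank C i)) := (u + ashift j)%MM.
have grCu i : graded (@su i.+1) (@su i) (adiff C i).
  by move=> j l m /grC; rewrite /su addmA [(m + u)%MM]addmC -addmA => ->.
pose P i (X : 'M[S]_(arank C i, arank A i)) :=
  graded (@su i) (@ashift A i) X /\
  exists Y : 'M[S]_(arank C i.+1, arank A i.+1),
    adiff C i *m X = Y *m adiff A i.
pose R i (X : 'M[S]_(arank C i, arank A i))
    (Y : 'M[S]_(arank C i.+1, arank A i.+1)) :=
  adiff C i *m X = Y *m adiff A i.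
have [|i X [grX [Y XY]]|phi [phi0E Pphi Rphi]] := @dependent_choice _ P R phi0.
- by [].
- pose Z := graded_part (@su i.+1) (@ashift A i.+1) Y.
  have ZE : Z *m adiff A i = adiff C i *m X.
    rewrite /Z XY (graded_part_mulmx (sr := @ashift A i)) //.
    by rewrite -XY; apply: gradedM (grX).
  exists Z => //; split; first exact: graded_partP.
  apply: acyclic_lift => //.
  by rewrite -mulmxA ZE mulmxA ddC mul0mx.
by exists phi; split=> // i; case: (Pphi i).
Qed.

(** Uniqueness of the shifts of a minimal resolution.  Composing comparison maps
    A -> B -> A gives a map homotopic to the identity, hence equal to it modulo
    the variables, so that every row of A -> B has an entry with nonzero constant
    coefficient; the two shifts that index this entry agree. *)
Lemma min_resolution_shift (I : S -> Prop) (A B : free_seq K n) k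
    (j : 'I_(rk A k)) :
    min_resolution I A -> min_resolution I B ->
  exists l : 'I_(rk B k), shift j = shift l.
Proof.
case=> /multigradedE grA /resolvesE[imA acA] minA.
case=> /multigradedE grB /resolvesE[imB acB] _.
have gr1 (C : free_seq K n) :
  graded (fun j => (0 + @ashift C 0 j)%MM) (@ashift C 0) (1%:M : 'M[S]_1).
  move=> i l m; rewrite !ord1 mxE eqxx msupp1 inE => /eqP->.
  by [].
have ex1 (C D : free_seq K n) :
    (forall f, (exists v : 'rV[S]_(rk C 0), f = (v *m aug C) 0 0) ->
       exists v : 'rV[S]_(rk D 0), f = (v *m aug D) 0 0) ->
  exists Y, adiff C 0 *m (1%:M : 'M[S]_1) = Y *m adiff D 0.
  move=> sCD; rewrite mulmx1.
  have ex i : exists w, row i (aug C) = w *m aug D.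
    have [|v cv] := sCD (aug C i 0).
      by exists (delta_mx 0 i); rewrite -rowE mxE.
    by exists v; apply/matrixP=> a b; rewrite !ord1 -cv mxE.
  pose w i := proj1_sig (constructive_indefinite_description _ (ex i)).
  exists (\matrix_i w i); apply/row_matrixP=> i; rewrite row_mul rowK.
  exact: proj2_sig (constructive_indefinite_description _ (ex i)).
have [|phi [phi0 grphi cphi]] :=
  chain_map acB grB grA (acyclic_comp acA) (gr1 B).
  by apply: ex1 => f /imA/imB.
have [|psi [psi0 _ cpsi]] := chain_map acA grA grB (acyclic_comp acB) (gr1 A).
  by apply: ex1 => f /imB/imA.
(* [chi] is null-homotopic, by a homotopy [h] with [h 0] zero. *)
pose chi i := phi i *m psi i - 1%:M.
have cchi i : adiff A i *m chi i = chi i.+1 *m adiff A i.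
  by rewrite mulmxBl mulmxBr mul1mx mulmx1 mulmxA cphi -!mulmxA cpsi.
pose R i (h : 'M[S]_(arank A i, arank A i.+1))
    (h' : 'M[S]_(arank A i.+1, arank A i.+2)) :=
  chi i.+1 = h' *m adiff A i.+1 + adiff A i *m h.
pose P i (h : 'M[S]_(arank A i, arank A i.+1)) :=
  adiff A i *m (chi i - h *m adiff A i) = 0.
have [||h [h0 _ hR]] := @dependent_choice _ P R 0.
- by rewrite /P mul0mx subr0 /chi phi0 psi0 mulmx1 subrr mulmx0.
- move=> i h Ph.
  have [|Y YE] := @acyclic_lift A i _ (chi i.+1 - adiff A i *m h) acA.
    by rewrite mulmxBl -cchi -mulmxA -mulmxBr.
  exists Y; last by rewrite /R -YE subrK.
  rewrite /P -YE opprB addrC subrK mulmxA acyclic_comp ?mul0mx //.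
(* At i = 0 minimality says nothing on the augmentation, but [h 0] vanishes. *)
have dh0 i (p q : 'I_(arank A i.+1)) : ((adiff A i *m h i) p q)@_0%MM = 0.
  case: i p q => [|i] p q; first by rewrite h0 mulmx0 mxE mcoeff0.
  rewrite mxE raddf_sum big1 //= => l _.
  by rewrite rmorphM /= (minA i p l) mul0r.
have chi0 : (chi k.+1 j j)@_0%MM = 0.
  rewrite hR mxE mcoeffD dh0 addr0 mxE raddf_sum big1 //= => l _.
  by rewrite rmorphM /= (minA k l j) mulr0.
have [l philN0] : exists l, (phi k.+1 j l)@_0%MM != 0.
  apply/existsP; apply: contraT; rewrite negb_exists => /forallP phi_0.
  move: chi0; rewrite /chi !mxE eqxx mcoeffB mcoeff1 eqxx raddf_sum big1 /=.
    by move/eqP; rewrite sub0r oppr_eq0 oner_eq0.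
  move=> l _; rewrite rmorphM /=; move: (phi_0 l); rewrite negbK => /eqP->.
  by rewrite mul0r.
exists l; have := grphi k.+1 j l 0%MM.
by rewrite mcoeff_msupp philN0 !add0m => /(_ isT)/esym.
Qed.

End Graded.

(** * Mapping cones *)

Section Cones.
Variables (K : fieldType) (n : nat).
Local Notation S := {mpoly K[n]}.
Implicit Types (W M : 'X_{1..n} -> Prop) (u : 'X_{1..n}).

(** The polynomials whose monomials all satisfy [W].  This is an ideal when [W] is
    stable under multiplication by monomials. *)
Definition monid W : S -> Prop := fun f => forall m, m \in msupp f -> W m.

Lemma monid_ext W W' f : (forall m, W m <-> W' m) -> monid W f <-> monid W' f.
Proof. by move=> WW'; split=> Wf m /Wf/WW'. Qed.

Lemma monidX W u : monid W 'X_[u] <-> W u.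
Proof.
by split=> [|Wu m]; [apply; rewrite msuppX inE | rewrite msuppX inE => /eqP->].
Qed.

Lemma mem_msuppMX u (f : S) m :
  m \in msupp (f * 'X_[u]) -> exists2 m', m' \in msupp f & m = (m' + u)%MM.
Proof.
rewrite (perm_mem (msuppMX f u)) => /mapP[m' m'f ->].
by exists m'; rewrite 1?addmC.
Qed.

Lemma monid_mulX W u f :
  monid W (f * 'X_[u]) <-> monid (fun m => W (m + u)%MM) f.
Proof.
split=> Wf m.
  move=> mf; apply: Wf; rewrite (perm_mem (msuppMX f u)); apply/mapP.
  by exists m; rewrite 1?addmC.
by case/mem_msuppMX=> m' /Wf Wm' ->.
Qed.

(** The monomials divisible by one in [M]. *)
Definition above M : 'X_{1..n} -> Prop := fun m => exists2 u, M u & (u <= m)%MM.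

Lemma midealE M (f : S) : mideal M f <-> monid (above M) f.
Proof.
split=> [[s [Ms ->]] m /msupp_sum_le/flatten_mapP[p]|Mf].
  rewrite filter_predT => ps /mem_msuppMX[m' _ ->].
  by exists p.2; [apply: Ms | apply: lem_addl].
pose g m := epsilon (inhabits 0%MM) (fun u => M u /\ (u <= m)%MM).
have gP m : m \in msupp f -> M (g m) /\ (g m <= m)%MM.
  case/Mf=> u Mu um.
  apply: (epsilon_spec (inhabits 0%MM) (fun u => M u /\ (u <= m)%MM)).
  by exists u.
exists [seq (f@_m *: 'X_[m - g m], g m) | m <- msupp f]; split.
  by move=> _ /mapP[m /gP[Mm _] ->].
rewrite big_map {1}[f]mpolyE big_seq [RHS]big_seq; apply: eq_bigr => m /gP[_ gm].
by rewrite /= -scalerAl -mpolyXD submK.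
Qed.

Lemma resolves_ext (F : free_seq K n) (I J : S -> Prop) :
  (forall f, I f <-> J f) -> resolves F I <-> resolves F J.
Proof.
move=> IJ; split=> -[h0 h1 h]; split=> // f; split.
- by move/IJ/h0.
- by move/h0/IJ.
- by move/IJ/h0.
- by move/h0/IJ.
Qed.

(** [a] is a shift in degree [i] of [F], respectively of [F] augmented by S. *)
Definition has_shift (F : free_seq K n) i a :=
  exists j : 'I_(rk F i), a = shift j.
Definition has_ashift (F : free_seq K n) i a :=
  exists j : 'I_(arank F i), a = ashift j.

(** A linear resolution is minimal: an entry of a differential with nonzero
    constant coefficient would relate shifts of equal total degree. *)
Lemma linear_minimal (F : free_seq K n) d :
    multigraded F -> (forall i a, has_shift F i a -> mdeg a = (d + i)%N) ->
  minimal F.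
Proof.
move=> [_ grF] linF i j l; apply/memN_msupp_eq0/negP=> /grF.
rewrite add0m => lj.
have := linF i (shift l) (ex_intro _ l erefl).
rewrite lj (linF i.+1); last by exists j.
by move/eqP; rewrite eqn_add2l gtn_eqF.
Qed.

(** Linear algebra of the mapping cone at one spot.  The cycle condition on the
    second component [c] is replaced by its being a boundary, since at the bottom
    of the cone this comes from the colon ideal instead of a differential. *)
Lemma cone_exact a0 a1 a2 c1 c2 (dA' : 'M[S]_(a2, a1)) (dA : 'M[S]_(a1, a0))
    (dC : 'M[S]_(c2, c1)) (p1 : 'M[S]_(c1, a0)) (p2 : 'M[S]_(c2, a1))
    (a : 'rV_a1) (c : 'rV_c1) :
    (forall v : 'rV_a1, v *m dA = 0 <-> exists w : 'rV_a2, v = w *m dA') ->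
    dC *m p1 = p2 *m dA ->
  (a *m dA + c *m p1 = 0 /\ exists c' : 'rV_c2, c = c' *m dC) <->
  exists w : 'rV_(a2 + c2), row_mx a c = w *m block_mx dA' 0 p2 (- dC).
Proof.
move=> exA comm; split=> [[ac0 [c' cE]]|[w]].
  have [|w wE] := (exA (a + c' *m p2)).1.
    by rewrite mulmxDl -mulmxA -comm mulmxA -cE.
  exists (row_mx w (- c')).
  by rewrite mul_row_block mulmx0 add0r -wE !mulNmx mulmxN opprK addrK cE.
rewrite -[w]hsubmxK mul_row_block mulmx0 add0r; case/eq_row_mx=> -> ->.
split; last by exists (- rsubmx w); rewrite mulNmx mulmxN.
rewrite mulmxDl (exA (lsubmx w *m dA')).2 ?add0r; last by exists (lsubmx w).
by rewrite -!mulmxA mulNmx mulmxN comm subrr.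
Qed.

(** Mapping cone.  If [A] resolves an ideal J and [C] resolves J : x^u, the
    cone of a lift [C](-u) -> [A] of multiplication by x^u resolves
    J + (x^u). *)
Lemma cone (A C : free_seq K n) u WA WC WE :
    multigraded A -> resolves A (monid WA) ->
    multigraded C -> resolves C (monid WC) ->
    (forall m, WC m <-> WA (m + u)%MM) ->
    (forall m, WE m <-> WA m \/ (u <= m)%MM) ->
  exists E : free_seq K n,
    [/\ multigraded E, resolves E (monid WE)
      & forall i a, has_shift E i a <->
          has_shift A i a \/ exists2 b, has_ashift C i b & a = (u + b)%MM].
Proof.
move=> /multigradedE grA /resolvesE[imA acA].
move=> /multigradedE grC /resolvesE[imC acC] colon sumE.
pose phi0 : 'M[S]_1 := ('X_[u])%:M.
have [||phi [phi0E grphi comm]] :=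
  @chain_map K n A C u phi0 acA grA grC (acyclic_comp acC).
- move=> i j m; rewrite !ord1 mxE eqxx mulr1n msuppX inE => /eqP-> /=.
  by rewrite !addm0.
- have ex j : exists w, row j (aug C *m phi0) = w *m aug A.
    have /imA[w wE] : monid WA (aug C j 0 * 'X_[u]).
      apply/monid_mulX/(monid_ext _ colon)/imC.
      by exists (delta_mx 0 j); rewrite -rowE mxE.
    exists w; apply/matrixP=> a b; rewrite !ord1 -wE mxE mul_mx_scalar mxE.
    by rewrite mulrC.
  pose w j := proj1_sig (constructive_indefinite_description _ (ex j)).
  exists (\matrix_j w j); apply/row_matrixP=> j; rewrite [RHS]row_mul rowK.
  exact: proj2_sig (constructive_indefinite_description _ (ex j)).
have phi0M (c : 'rV[S]_(arank C 0)) : (c *m phi 0%N) 0 0 = c 0 0 * 'X_[u].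
  by rewrite phi0E mul_mx_scalar mxE mulrC.
pose sE i (j : 'I_(rk A i + arank C i)) :=
  match split j with inl a => shift a | inr c => (u + ashift c)%MM end.
have sEl i j : sE i (lshift _ j) = shift j by rewrite /sE (unsplitK (inl j)).
have sEr i j : sE i (rshift _ j) = (u + ashift j)%MM.
  by rewrite /sE (unsplitK (inr j)).
pose E := @FreeSeq K n (fun i => rk A i + arank C i)%N sE
  (col_mx (aug A) (phi 0%N))
  (fun i => block_mx (diff A i) 0 (phi i.+1) (- adiff C i)).
exists E; split; last first.
- move=> i a; split=> [[j ->]|[[j ->]|[b [j ->] ->]]].
  + rewrite /E /=; case: (split_ordP j) => j' ->; rewrite ?sEl ?sEr.
      by left; exists j'.
    by right; exists (ashift j') => //; exists j'.
  + by exists (lshift _ j); rewrite /= sEl.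
  + by exists (rshift _ j); rewrite /= sEr.
- apply/resolvesE; split=> [f|].
    split=> [WEf|[v ->]].
      (* The part of [f] divisible by 'X_[u] is carried by the new generator. *)
      pose f1 := \sum_(m <- msupp f | (u <= m)%MM) f@_m *: 'X_[m - u].
      pose f0 := \sum_(m <- msupp f | ~~ (u <= m)%MM) f@_m *: 'X_[m].
      have fE : f = f0 + f1 * 'X_[u].
        rewrite {1}[f]mpolyE (bigID (fun m => (u <= m)%MM)) /= addrC.
        congr (_ + _); rewrite mulr_suml; apply: eq_bigr => m um.
        by rewrite -scalerAl -mpolyXD submK.
      have /imA[a aE] : monid WA f0.
        move=> m /msupp_sum_le/flatten_mapP[m']; rewrite mem_filter.
        case/andP=> um' m'f /msuppZ_le; rewrite msuppX inE => /eqP->.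
        by have /sumE[|] := WEf _ m'f; rewrite // (negPf um').
      exists (row_mx a (const_mx f1)).
      by rewrite /= mul_row_col mxE phi0M -aE [const_mx _ _ _]mxE.
    rewrite -[v]hsubmxK /= mul_row_col mxE phi0M => m.
    move/msuppD_le; rewrite mem_cat => /orP[].
      move=> mA; apply/sumE; left; move: m mA.
      by apply/imA; exists (lsubmx v).
    by case/mem_msuppMX=> m' _ ->; apply/sumE; right; apply: lem_addl.
  case=> [|i] v; rewrite -[v]hsubmxK /=.
    (* [c] 'X_[u] is in J, that is [c] is in J : x^u, resolved by [C]. *)
    rewrite mul_row_col.
    rewrite -(cone_exact _ _ (acA 0%N) (comm 0%N)).
    split=> [ac0|[]//]; split=> //.
    have /imC[c' cE] : monid WC (rsubmx v 0 0).
      apply/(monid_ext _ colon)/monid_mulX; rewrite -phi0M; apply/imA.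
      exists (- lsubmx v); rewrite mulNmx.
      by move/eqP: ac0; rewrite addrC addr_eq0 => /eqP->.
    by exists c'; apply/matrixP=> i j; rewrite !ord1 cE.
  rewrite mul_row_block mulmx0 add0r.
  rewrite -(cone_exact _ _ (acA i.+1) (comm i.+1)) -acC.
  rewrite -[0 in X in X <-> _]row_mx0 mulmxN.
  split=> [/eq_row_mx[-> /eqP]|[-> ->]]; last by rewrite oppr0.
  by rewrite oppr_eq0 => /eqP->.
- apply/multigradedE=> -[|i] j l m /=.
    rewrite ord1; case: (split_ordP j) => j' -> /=.
      by rewrite col_mxEu sEl => /(grA 0%N).
    by rewrite col_mxEd sEr => /grphi.
  case: (split_ordP j) => j' ->; case: (split_ordP l) => l' ->;
    rewrite ?sEl ?sEr.
  + by rewrite block_mxEul => /(grA i.+1).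
  + by rewrite block_mxEur mxE msupp0.
  + by rewrite block_mxEdl => /grphi.
  + rewrite block_mxEdr mxE (perm_mem (msuppN _)) => /grC <-.
    by rewrite addmA [(m + u)%MM]addmC -addmA.
Qed.

End Cones.

(** * Linear quotients *)

Section LinearQuotients.
Variables (K : fieldType) (n : nat).
Local Notation S := {mpoly K[n]}.

Lemma mesym1U1 x (s : {set 'I_n}) :
  x \notin s -> mesym1 (x |: s) = (U_(x) + mesym1 s)%MM.
Proof.
move=> xs; apply/mnmP=> i; rewrite mnmDE mnm1E !mnmE in_setU1 eq_sym.
by case: eqP => // <-; rewrite (negPf xs).
Qed.

Lemma zero_resolution : exists F : free_seq K n,
  [/\ multigraded F, resolves F (monid (fun=> False))
    & forall i a, ~ has_shift F i a].
Proof.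
exists (@FreeSeq K n (fun=> 0%N) (fun _ _ => 0%MM) 0 (fun=> 0)).
split=> [||i a [[]]//]; first by split=> [[]|i []].
apply/resolvesE; split=> [f|].
  split=> [f0|[v ->]]; last by rewrite mulmx0 mxE => m; rewrite msupp0.
  exists 0; rewrite mul0mx mxE; apply: msuppnil0.
  by case fE: (msupp f) => [//|m s]; case: (f0 m); rewrite fE mem_head.
case=> [|i] v; split=> _; rewrite ?mulmx0 //;
  by exists 0; apply/matrixP=> ? [].
Qed.

(** The Koszul complex on the variables in [s], as an iterated cone: the ideal
    generated by the other variables is its own colon by the first one. *)
Lemma koszul_resolution (s : seq 'I_n) : uniq s -> exists F : free_seq K n,
  [/\ multigraded F,
      resolves F (monid (fun m => exists2 i, i \in s & (0 < m i)%N))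
    & forall i a, has_ashift F i a <->
        exists2 t : {set 'I_n}, t \subset s /\ #|t| = i & a = mesym1 t].
Proof.
have shift0 (F : free_seq K n) s' a : has_ashift F 0 a <->
    exists2 t : {set 'I_n},
      t \subset (s' : seq 'I_n) /\ #|t| = 0%N & a = mesym1 t.
  split=> [[j ->]|[t [_ /cards0_eq->] ->]].
    exists set0; rewrite ?cards0 ?mesym1_set0 //; split=> //.
    by apply/subsetP=> x; rewrite inE.
  by rewrite mesym1_set0; exists 0.
elim: s => [_|x s IHs /= /andP[xs us]].
  have [F [grF resF noF]] := zero_resolution.
  exists F; split=> // [|[|i] a].
  - apply: (resolves_ext _ _).2 resF => f; apply: monid_ext => m.
    by split=> // -[].
  - exact: shift0.
  - split=> [/noF//|[t [/subset_leq_card + ti]]].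
    by rewrite ti card0.
have [F [grF resF shF]] := IHs us.
have [||E [grE resE shE]] := @cone K n F F U_(x) _ _
  (fun m => exists2 i, i \in x :: s & (0 < m i)%N) grF resF grF resF.
- move=> m; split=> -[i si mi]; exists i => //.
    by rewrite mnmDE ltn_addr.
  move: mi; rewrite mnmDE mnm1E; case: eqP => [xi|_]; last by rewrite addn0.
  by rewrite xi si in xs.
- move=> m; rewrite lep1mP -lt0n; split=> [[i]|[[i si mi]|mx]].
  + by rewrite inE => /predU1P[->|si] mi; [right | left; exists i].
  + by exists i; rewrite // inE si orbT.
  + by exists x; rewrite // mem_head.
exists E; split=> // -[|i] a; first exact: shift0.
split=> [/shE[/(shF i.+1)[t [ts ti] ->]|[b /shF[t [ts ti] ->] ->]]
        |[t [ts ti] ->]].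
- exists t => //; split=> //; apply: subset_trans ts _.
  by apply/subsetP=> y; rewrite inE orbC => ->.
- have xt : x \notin t by apply: contra xs; apply: (subsetP ts).
  exists (x |: t); last by rewrite mesym1U1.
  rewrite cardsU1 xt ti; split=> //; apply/subsetP=> y; rewrite !inE.
  by case: (y == x) => //= /(subsetP ts).
- apply/shE; have [xt|xt] := boolP (x \in t); [right | left].
  + exists (mesym1 (t :\ x)); last by rewrite -mesym1U1 ?setD11 // setD1K.
    apply/shF; exists (t :\ x) => //; split.
      apply/subsetP=> y; rewrite !inE => /andP[/negPf yx /(subsetP ts)].
      by rewrite inE yx.
    by apply/eqP; rewrite -eqSS -ti (cardsD1 x t) xt.
  + apply/(shF i.+1); exists t => //; split=> //; apply/subsetP=> y yt.
    have := subsetP ts y yt; rewrite inE => /predU1P[yx|//].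
    by rewrite -yx yt in xt.
Qed.

(** Ideals with linear quotients.  The generators are adjoined from the last to
    the first in [L]; adjoining [u] adds a shifted Koszul complex, on the
    variables [g u] generating the colon ideal. *)
Lemma linear_quotients (g : 'X_{1..n} -> {set 'I_n}) (L : seq 'X_{1..n}) :
    (forall L1 u L2, L = L1 ++ u :: L2 -> forall m,
       above (fun v => v \in L2) (m + u)%MM <->
       exists2 i, i \in g u & (0 < m i)%N) ->
  exists F : free_seq K n,
    [/\ multigraded F, resolves F (monid (above (fun u => u \in L)))
      & forall i a, has_shift F i a <->
          exists2 u, u \in L & exists2 t : {set 'I_n},
            t \subset g u /\ #|t| = i & a = (u + mesym1 t)%MM].
Proof.
elim: L => [_|u L IHL colon].
  have [F [grF resF noF]] := zero_resolution.
  exists F; split=> // [|i a].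
    apply: (resolves_ext _ _).2 resF => f; apply: monid_ext => m.
    by split=> // -[].
  by split=> [/noF|[]].
have [L1 v L2 LE|A [grA resA shA]] := IHL.
  by apply: (colon (u :: L1)); rewrite LE.
have [C [grC resC shC]] := koszul_resolution (enum_uniq (g u)).
have [||E [grE resE shE]] := @cone K n A C u _ _
  (above (fun v => v \in u :: L)) grA resA grC resC.
- move=> m; rewrite (colon [::] u L erefl m).
  by split=> -[i gi mi]; exists i; rewrite // mem_enum in gi *.
- move=> m; split=> [[v]|[[v Lv vm]|um]].
  + by rewrite inE => /predU1P[->|Lv] vm; [right | left; exists v].
  + by exists v; rewrite // inE Lv orbT.
  + by exists u; rewrite // mem_head.
exists E; split=> // i a.
have subE (t : {set 'I_n}) : (t \subset enum (g u)) = (t \subset g u).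
  by apply: eq_subset_r => y; rewrite mem_enum.
split=> [/shE[/shA[v Lv [t tP ->]]|[b /shC[t [tg ti] ->] ->]]|].
- by exists v; [rewrite inE Lv orbT | exists t].
- by exists u; [rewrite mem_head | exists t; rewrite // -subE].
case=> v; rewrite inE => /predU1P[->|Lv] [t [tg ti] ->]; apply/shE.
  by right; exists (mesym1 t) => //; apply/shC; exists t; rewrite ?subE.
by left; apply/shA; exists v => //; exists t.
Qed.

End LinearQuotients.

(** * Borel moves on sets of variables *)

Section BorelSets.
Variable n : nat.
Implicit Types (A B s t X : {set 'I_n}) (i j : 'I_n) (G J : {set 'I_n} -> Prop).

(** The gaps of the squarefree monomial with support [A]. *)
Definition sgap A : {set 'I_n} :=
  [set i | (i \notin A) && [exists j in A, (i < j)%N]].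

Lemma sgapP A i :
  reflect (i \notin A /\ exists2 j, j \in A & (i < j)%N) (i \in sgap A).
Proof.
rewrite inE; apply: (iffP andP) => -[iA].
  by case/exists_inP=> j; split=> //; exists j.
by case=> j jA ij; split=> //; apply/exists_inP; exists j.
Qed.

Lemma disjoint_sgap A t : t \subset sgap A -> [disjoint A & t].
Proof.
move=> tA; rewrite disjoint_sym disjoints_subset; apply/subsetP=> x.
by move/(subsetP tA)/sgapP=> []; rewrite inE.
Qed.

(** Stability under replacing a variable of a squarefree monomial by an earlier
    one that does not occur in it. *)
Definition borel_closed G := forall A i j,
  G A -> j \in A -> i \notin A -> (i < j)%N -> G (i |: A :\ j).

Lemma card_swap A i j : j \in A -> i \notin A -> #|i |: A :\ j| = #|A|.
Proof.
by move=> jA iA; rewrite cardsU1 (cardsD1 j A) jA !inE (negPf iA) andbF.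
Qed.

(** The sets obtained by adding [k] gaps to an element of [G]. *)
Definition with_gaps k G : {set 'I_n} -> Prop := fun B =>
  exists A t, [/\ G A, t \subset sgap A, #|t| = k & B = A :|: t].

(** The delicate move is that of the last element [j] of [A] to [i]: elements of
    [t] may then stop being gaps.  In that case the largest element [s] of [t]
    takes the place of [j] in [A], and [i] that of [s] in [t]. *)
Lemma with_gaps_closed k G : borel_closed G -> borel_closed (with_gaps k G).
Proof.
move=> clG _ i j [A [t [GA tA tk ->]]]; rewrite in_setU orbC => jAt.
rewrite in_setU negb_or => /andP[iA it] ij.
have tNA x : x \in t -> x \notin A by move/(subsetP tA)/sgapP=> [].
case: (boolP (j \in t)) jAt => [jt _|jt /= jA].
  have [jA [a aA ja]] := sgapP _ _ (subsetP tA _ jt).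
  exists A, (i |: t :\ j); split; rewrite ?card_swap //.
    apply/subsetP=> x; rewrite in_setU1 in_setD1.
    case/predU1P=> [->|/andP[_ /(subsetP tA)//]].
    by apply/sgapP; split=> //; exists a; rewrite ?(ltn_trans ij).
  apply/setP=> x; rewrite !inE.
  by have [->|_] := eqVneq x j; rewrite ?(negPf jA) //= orbCA.
have ji : j != i by rewrite neq_ltn ij orbT.
pose A1 := i |: A :\ j.
have GA1 : G A1 by apply: clG.
have [tA1|] := boolP (t \subset sgap A1).
  exists A1, t; split=> //; apply/setP=> x; rewrite !inE.
  by case: (eqVneq x j) => [->|_]; rewrite ?(negPf jt) ?(negPf ji) //= orbA.
case/subsetPn=> s0 s0t s0A1.
case: (arg_maxnP (fun x : 'I_n => x : nat) s0t) => s /= st smax.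
have {}st : s \in t by [].
have s_i : s != i by apply: contraNneq it => <-.
have sA := tNA s st.
(* As [s0] is not a gap of [A1], all of [A1] lies below [s0], hence below [s];
   so [j] is the element of [A] above the gap [s]. *)
have A1s a : a \in A1 -> (a < s)%N.
  move=> aA1; have sa : a != s.
    by apply: contraTneq aA1 => ->; rewrite !inE (negPf s_i) (negPf sA) andbF.
  rewrite ltn_neqAle val_eqE sa /=; apply: leq_trans (smax _ s0t).
  rewrite leqNgt; apply: contra s0A1 => s0a; apply/sgapP; split; last by exists a.
  rewrite !inE (negPf (tNA _ s0t)) andbF orbF.
  by apply: contraNneq it => <-.
have sj : (s < j)%N.
  have [_ [a aA sa]] := sgapP _ _ (subsetP tA _ st).
  have [<-//|aj] := eqVneq a j.
  by have := A1s a; rewrite !inE aj aA orbT ltnNge (ltnW sa) => /(_ isT).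
have s_j : s != j by rewrite neq_ltn sj.
have is_ : (i < s)%N by apply: A1s; rewrite setU11.
exists (s |: A :\ j), (i |: t :\ s); split.
- exact: clG.
- apply/subsetP=> x xt; apply/sgapP; split; last first.
    exists s; rewrite ?setU11 //; move: xt; rewrite !inE.
    case/predU1P=> [->//|/andP[xs xt]].
    by rewrite ltn_neqAle val_eqE xs; apply: smax.
  move: xt; rewrite !inE => /predU1P[->|/andP[xs xt]].
    by rewrite (negPf iA) andbF orbF eq_sym.
  by rewrite (negPf xs) (negPf (tNA x xt)) andbF.
- by rewrite card_swap.
apply/setP=> x; rewrite !inE.
have [->|xs] := eqVneq x s; first by rewrite st (negPf s_j) !orbT.
have [->|xj] := eqVneq x j; last by rewrite /= orbCA.
by rewrite (negPf jt) !andbF.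
Qed.

(** Adding any [k] gaps to [A] leads into [J]. *)
Definition gap_full k J : {set 'I_n} -> Prop := fun A =>
  forall t, t \subset sgap A -> #|t| = k -> J (A :|: t).

(** Let [t] be a set of gaps of the moved set i |: A :\ j.  If [j] is in [t], then
    adding [t] to the moved set amounts to adding the gaps i |: t :\ j to [A];
    otherwise it amounts to a Borel move of A :|: t. *)
Lemma gap_full_closed k J : borel_closed J -> borel_closed (gap_full k J).
Proof.
move=> clJ A i j fA jA iA ij t tA1 tk.
have tP x : x \in t -> [/\ x != i, x == j \/ x \notin A
                     & exists2 a, a \in A & (x < a)%N].
  move/(subsetP tA1)/sgapP; rewrite !inE negb_or negb_and negbK.
  case=> /andP[xi /orP xjA] [a aA xa]; split=> //.
  move: aA; rewrite !inE => /predU1P[ai|/andP[_ aA]]; last by exists a.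
  by exists j; rewrite // (ltn_trans xa) // ai.
have it : i \notin t by apply/negP=> /tP[]; rewrite eqxx.
have [jt|jt] := boolP (j \in t).
  have -> : i |: A :\ j :|: t = A :|: (i |: t :\ j).
    apply/setP=> x; rewrite !inE.
    by have [->|xj] := eqVneq x j; rewrite ?jA ?jt ?orbT //= -orbA orbCA.
  apply: fA; last by rewrite card_swap.
  apply/subsetP=> x; rewrite in_setU1 in_setD1.
  case/predU1P=> [->|/andP[xj /tP[_]]].
    by apply/sgapP; split=> //; exists j.
  by rewrite (negPf xj) => -[//|xA] xa; apply/sgapP.
have -> : i |: A :\ j :|: t = i |: (A :|: t) :\ j.
  apply/setP=> x; rewrite !inE.
  by have [->|xj] := eqVneq x j; rewrite ?(negPf jt) ?orbF //= orbA.
apply: clJ; rewrite ?inE ?jA ?negb_or ?iA //.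
apply: fA => //; apply/subsetP=> x xt; have [_ xjA xa] := tP x xt.
by apply/sgapP; split=> //; case: xjA => // /eqP xj; rewrite -xj xt in jt.
Qed.

(** The [k] largest elements of [X], or [X] if it has at most [k]. *)
Definition topk k X : {set 'I_n} :=
  [set i in X | (#|[set j in X | (i < j)%N]| < k)%N].

Lemma topk_sub k X : topk k X \subset X.
Proof. by apply/subsetP=> i; rewrite inE => /andP[]. Qed.

Lemma lt_topk k X i j :
  i \in X -> i \notin topk k X -> j \in topk k X -> (i < j)%N.
Proof.
rewrite !inE => -> /=; rewrite -leqNgt => ki /andP[jX jk].
rewrite ltnNge; apply/negP=> ji; have := leq_trans jk ki.
rewrite ltnNge subset_leq_card //; apply/subsetP=> x; rewrite !inE.
by case/andP=> -> /(leq_ltn_trans ji).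
Qed.

(** By induction, removing the least element [y] of [X]. *)
Lemma card_topk k X : (k <= #|X|)%N -> #|topk k X| = k.
Proof.
move Xm: #|X| => m; elim: m X Xm k => [|m IH] X Xm k kX.
  move: kX; rewrite leqn0 => /eqP->; apply/eqP.
  by rewrite -leqn0 -Xm subset_leq_card ?topk_sub.
have [x xX] : exists x, x \in X by apply/card_gt0P; rewrite Xm.
case: (arg_minnP (fun x : 'I_n => x : nat) xX) => y /= yX ymin.
have {}yX : y \in X by [].
have {}ymin i : i \in X -> (y <= i)%N by apply: ymin.
have Xy : #|X :\ y| = m by apply/eqP; rewrite -eqSS -Xm (cardsD1 y X) yX.
have rk_lt i : i \in X ->
    [set j in X | (i < j)%N] = [set j in X :\ y | (i < j)%N].
  move=> iX; apply/setP=> j; rewrite !inE.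
  by have [->|//] := eqVneq j y; rewrite ltnNge (ymin i iX) andbF.
move: kX; rewrite leq_eqVlt ltnS => /predU1P[->|kX].
  rewrite -Xm; apply/eq_card=> i; rewrite inE andb_idr // => iX.
  rewrite Xm rk_lt // ltnS -Xy subset_leq_card //.
  by apply/subsetP=> j; rewrite inE => /andP[].
rewrite -[RHS](IH (X :\ y)) //; apply: eq_card=> i; rewrite !inE.
have [->|iy] := eqVneq i y; last first.
  by rewrite /=; case iX: (i \in X); rewrite //= rk_lt.
rewrite yX rk_lt //= ltnNge (leq_trans kX) //= -Xy.
apply: subset_leq_card; apply/subsetP=> j; rewrite !inE => /andP[jy jX].
by rewrite jy jX ltn_neqAle eq_sym val_eqE jy; apply: ymin.
Qed.

Lemma topkS k X :
  (k <= #|X|)%N -> topk k X :|: topk 1 (X :\: topk k X) = topk k.+1 X.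
Proof.
move=> kX; apply/setP=> i; rewrite in_setU [i \in topk 1 _]inE in_setD.
have [iT|iT] /= := boolP (i \in topk k X).
  by move: iT; rewrite !inE => /andP[-> /ltnW].
rewrite [RHS]inE; case iX: (i \in X) => //=; rewrite ltnS leqn0 ltnS cards_eq0.
have ki : (k <= #|[set j in X | (i < j)%N]|)%N.
  by move: iT; rewrite inE iX /= -leqNgt.
apply/eqP/idP=> [X0|ik].
  rewrite -[leqRHS](card_topk kX) subset_leq_card //; apply/subsetP=> j jXi.
  move: jXi; rewrite inE => /andP[jX ij]; apply: contraT => jT.
  by have := in_set0 j; rewrite -X0 inE in_setD jT jX ij.
apply/setP=> j; rewrite in_set0 inE in_setD; apply/negP=> /andP[/andP[jT jX] ij].
move: jT; rewrite inE jX /= -leqNgt leqNgt => /negP; apply.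
apply: leq_trans ik; apply: proper_card; apply/properP; split.
  by apply/subsetP=> x; rewrite !inE => /andP[-> /(ltn_trans ij)].
by exists j; rewrite !inE jX ?ij ?ltnn.
Qed.

(** Replacing [s] by a set [t] of the same size is a sequence of Borel moves, if
    the elements that come in are smaller than those that go out. *)
Lemma exchange J A s t : borel_closed J ->
    [disjoint A & s] -> [disjoint A & t] -> #|s| = #|t| ->
    (forall x y, x \in t :\: s -> y \in s :\: t -> (x < y)%N) ->
  J (A :|: s) -> J (A :|: t).
Proof.
move=> clJ + At; move tsm: #|t :\: s| => m.
elim: m s tsm => [|m IH] s tsm As st lt_ts Js.
  suff -> : t = s by [].
  by apply/eqP; rewrite eqEcard st leqnn -setD_eq0 -cards_eq0 tsm eqxx.
have /card_gt0P[x xts] : (0 < #|t :\: s|)%N by rewrite tsm.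
have /card_gt0P[y yst] : (0 < #|s :\: t|)%N.
  suff -> : #|s :\: t| = #|t :\: s| by rewrite tsm.
  by apply: (@addnI #|s :&: t|); rewrite cardsID setIC cardsID st.
have xy := lt_ts x y xts yst.
move: (xts) (yst); rewrite !inE => /andP[xs xt] /andP[yt ys].
have xA : x \notin A by rewrite (disjointFl At).
have yA : y \notin A by rewrite (disjointFl As).
have s'E : A :|: (x |: s :\ y) = x |: (A :|: s) :\ y.
  apply/setP=> z; rewrite !inE.
  by have [->|_] := eqVneq z y; rewrite ?(negPf yA) //= orbCA.
apply: (IH (x |: s :\ y)).
- apply/eqP; rewrite -eqSS -tsm (cardsD1 x (t :\: s)) xts eqSS.
  apply/eqP/eq_card=> z.
  rewrite !inE; have [->//|_] := eqVneq z x => /=.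
  by have [->|_] := eqVneq z y; rewrite ?(negPf yt) ?andbF.
- rewrite disjoint_sym disjoints_subset; apply/subsetP=> z; rewrite !inE.
  by case/predU1P=> [->//|/andP[_ zs]]; rewrite (disjointFl As).
- by rewrite card_swap.
- move=> z w; rewrite !inE negb_or negb_and negbK.
  case/andP=> /andP[zx /predU1P[zy|zs]] zt.
    by rewrite -zy zt in yt.
  case/andP=> wt /predU1P[wx|/andP[_ ws]]; first by rewrite wx xt in wt.
  by apply: lt_ts; rewrite inE ?zs ?wt.
- by rewrite s'E; apply: clJ; rewrite ?inE ?ys ?orbT // negb_or xA.
Qed.

Lemma gap_full_topk k J A :
    borel_closed J -> (k <= #|sgap A|)%N -> J (A :|: topk k (sgap A)) ->
  gap_full k J A.
Proof.
move=> clJ kA JA t tA tk; apply: exchange JA => //.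
- exact/disjoint_sgap/topk_sub.
- exact: disjoint_sgap.
- by rewrite card_topk.
move=> x y; rewrite !in_setD => /andP[xT xt] /andP[_ yT].
exact: lt_topk (subsetP tA x xt) xT yT.
Qed.

End BorelSets.

(** * Squarefree monomials *)

Section SquarefreeMonomials.
Variable n : nat.
Implicit Types (A B t X : {set 'I_n}) (u : 'X_{1..n}).

Lemma supp_mesym1 A : supp (mesym1 A) = A.
Proof. by apply/setP=> i; rewrite inE mnmE; case: (i \in A). Qed.

Lemma sqfree_mesym1 A : sqfree (mesym1 A).
Proof. by apply/forallP=> i; rewrite mnmE leq_b1. Qed.

Lemma sqfreeE u : sqfree u -> u = mesym1 (supp u).
Proof.
move/forallP=> u1; apply/mnmP=> i; rewrite mnmE inE.
by case: (u i) (u1 i) => [|[|]].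
Qed.

Lemma lem_mesym1 A B : (mesym1 A <= mesym1 B)%MM = (A \subset B).
Proof.
apply/mnm_lepP/subsetP=> [AB i iA|AB i].
  by have := AB i; rewrite !mnmE iA; case: (i \in B).
by rewrite !mnmE; case: (boolP (i \in A)) => // /AB->.
Qed.

Lemma mesym1_swap A i j : j \in A -> i \notin A ->
  (mesym1 A - U_(j) + U_(i))%MM = mesym1 (i |: A :\ j).
Proof.
move=> jA iA; apply/mnmP=> x; rewrite mnmDE mnmBE !mnm1E !mnmE !inE.
rewrite ![_ == x]eq_sym.
have [->|xi] := eqVneq x i; first by rewrite (negPf iA) sub0n.
have [->|xj] := eqVneq x j; first by rewrite jA.
by rewrite subn0 addn0.
Qed.

Lemma mesym1U A t : [disjoint A & t] ->
  mesym1 (A :|: t) = (mesym1 A + mesym1 t)%MM.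
Proof.
move=> At; apply/mnmP=> i; rewrite mnmDE !mnmE inE.
by case: (boolP (i \in A)) => // iA; rewrite (disjointFr At).
Qed.

Lemma gap_mesym1 A : gap (mesym1 A) = sgap A.
Proof.
apply/setP=> i; rewrite inE [in RHS]inE supp_mesym1 andbC; congr (_ && _).
rewrite /max_supp supp_mesym1; apply/idP/exists_inP=> [|[j jA ij]].
  rewrite ltnNge => /negP iA; apply/exists_inP; apply: contraT.
  rewrite negb_exists_in => /forall_inP iNA; case: iA.
  by apply/bigmax_leqP=> j jA; rewrite ltnS leqNgt iNA.
exact: (bigmax_sup j).
Qed.

Lemma sum_mnm1 X : (\sum_(i in X) U_(i))%MM = mesym1 X.
Proof.
apply/mnmP=> i; rewrite mnm_sumE mnmE big_mkcond (bigD1 i) //= mnm1E eqxx.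
rewrite big1 ?addn0 => [|j /negPf ji]; first by case: (i \in X).
by rewrite mnm1E ji if_same.
Qed.

Lemma mul_max_gaps_mesym1 k A :
  mul_max_gaps k (mesym1 A) = mesym1 (A :|: topk k (sgap A)).
Proof.
rewrite /mul_max_gaps /max_gaps gap_mesym1 -/(topk _ _) sum_mnm1 -mesym1U //.
exact/disjoint_sgap/topk_sub.
Qed.

Lemma sgapU A t : t \subset sgap A -> sgap (A :|: t) = sgap A :\: t.
Proof.
move=> tA; apply/setP=> i; rewrite in_setD.
apply/sgapP/andP=> [[]|[it /sgapP[iA [j jA ij]]]]; last first.
  by rewrite in_setU negb_or iA it; split=> //; exists j; rewrite // inE jA.
rewrite in_setU negb_or => /andP[iA it] [j jAt ij]; split=> //.
apply/sgapP; split=> //; move: jAt; rewrite inE => /orP[jA|]; first by exists j.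
move/(subsetP tA)/sgapP=> [_ [a aA ja]]; exists a => //.
exact: ltn_trans ja.
Qed.

Lemma mul_max_gaps_add1 k A : (k <= #|sgap A|)%N ->
  mul_max_gaps 1 (mul_max_gaps k (mesym1 A)) = mul_max_gaps k.+1 (mesym1 A).
Proof.
move=> kA; rewrite !mul_max_gaps_mesym1 sgapU ?topk_sub //.
by rewrite -setUA topkS.
Qed.

Lemma mnmwgt_mesym1 A : mnmwgt (mesym1 A) = (\sum_(i in A) i.+1)%N.
Proof.
rewrite /mnmwgt [RHS]big_mkcond; apply: eq_bigr => i _.
by rewrite mnmE; case: (i \in A); rewrite ?mul1n ?mul0n.
Qed.

(** The squarefree monomials with support in the family [G]. *)
Definition mons (G : {set 'I_n} -> Prop) : 'X_{1..n} -> Prop :=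
  fun u => exists2 A, G A & u = mesym1 A.

(** If every element of [B] outside [A] lies above all of [A], then [B] has
    larger weight than [A]. *)
Lemma mnmwgt_ltn A B : #|A| = #|B| -> A != B ->
    (forall i j, i \in A -> j \in B :\: A -> (i < j)%N) ->
  (mnmwgt (mesym1 A) < mnmwgt (mesym1 B))%N.
Proof.
move=> AB neqAB ltAB.
rewrite !mnmwgt_mesym1 (big_setID B) [leqRHS](big_setID A) /=.
rewrite setIC ltn_add2l; pose N := (\max_(i in A) i.+1)%N.
have cAB : #|A :\: B| = #|B :\: A|.
  by apply: (@addnI #|A :&: B|); rewrite cardsID setIC cardsID.
apply: (@leq_ltn_trans (#|B :\: A| * N)).
  rewrite -cAB -sum_nat_const leq_sum // => i; rewrite inE => /andP[_ iA].
  exact: (bigmax_sup i).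
apply: (@leq_trans (#|B :\: A| * N.+1)).
  rewrite ltn_pmul2l ?ltnS // card_gt0 setD_eq0; apply: contra neqAB => sBA.
  by rewrite eq_sym eqEcard sBA AB leqnn.
rewrite -sum_nat_const leq_sum // => j jBA; rewrite ltnS.
by apply/bigmax_leqP=> i iA; apply: ltAB.
Qed.

(** Listed by decreasing weight, the generators of an equigenerated squarefree
    Borel ideal have linear quotients, with colon ideals generated by gaps. *)
Lemma borel_linear_quotients (G : {set 'I_n} -> Prop) d :
    borel_closed G -> (forall A, G A -> #|A| = d) ->
  exists2 L : seq 'X_{1..n}, forall u, u \in L <-> mons G u &
    forall L1 u L2, L = L1 ++ u :: L2 -> forall m,
      above (fun v => v \in L2) (m + u)%MM <->
      exists2 i, i \in gap u & (0 < m i)%N.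
Proof.
move=> clG dG; pose leT (u v : 'X_{1..n}) := (mnmwgt v <= mnmwgt u)%N.
have leT_tr : transitive leT by move=> v u w /[swap]; apply: leq_trans.
have leT_tot : total leT by move=> u v; apply: leq_total.
pose Gb A : bool := if excluded_middle_informative (G A) then true else false.
have GbP A : Gb A <-> G A by rewrite /Gb; case: excluded_middle_informative.
pose s := [seq mesym1 A | A <- enum Gb].
have sP u : u \in sort leT s <-> mons G u.
  rewrite mem_sort; split=> [/mapP[A]|[A /GbP GA ->]].
    by rewrite mem_enum => /GbP GA ->; exists A.
  by apply: map_f; rewrite mem_enum.
exists (sort leT s) => // L1 u L2 LE m.
have uL : uniq (sort leT s).
  by rewrite sort_uniq map_inj_uniq ?enum_uniq //; apply: inj_mesym1.
have [A GA uE] : mons G u by apply/sP; rewrite LE mem_cat mem_head orbT.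
have : pairwise leT (sort leT s) by rewrite -sorted_pairwise // sort_sorted.
rewrite LE pairwise_cat /= => /and3P[/allrelP leL1 _ /andP[/allP leL2 _]].
rewrite uE gap_mesym1; split=> [[v vL2 vm]|[i iA mi]].
  have [B GB vE] : mons G v by apply/sP; rewrite LE mem_cat inE vL2 !orbT.
  apply/exists_inP; apply: contraT; rewrite negb_exists_in => /forall_inP m0.
  have := leL2 _ vL2; rewrite /leT uE vE leqNgt => /negP[].
  apply: mnmwgt_ltn; first by rewrite (dG A) ?(dG B).
    apply/eqP=> AB; move: uL; rewrite LE cat_uniq /= uE AB -vE vL2.
    by rewrite !andbF.
  move=> i j iA; rewrite in_setD => /andP[jA jB]; rewrite ltnNge; apply/negP=> ji.
  have /m0/negP[] : j \in sgap A.
    apply/sgapP; split=> //; exists i => //; rewrite ltn_neqAle ji andbT.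
    by apply: contraNneq jA => /val_inj->.
  move/mnm_lepP/(_ j): vm; rewrite mnmDE vE !mnmE jB (negPf jA) addn0.
  exact.
have [iNA [j jA ij]] := sgapP _ _ iA.
exists (mesym1 (i |: A :\ j)); last first.
  apply/mnm_lepP=> x; rewrite mnmDE !mnmE !inE.
  have [->|_] /= := eqVneq x i; first by rewrite ltn_addr.
  rewrite (leq_trans _ (leq_addl _ _)) //.
  by case: (x \in A); rewrite ?andbF ?leq_b1.
have : mesym1 (i |: A :\ j) \in sort leT s.
  by apply/sP; exists (i |: A :\ j) => //; apply: clG.
have wlt : (mnmwgt (mesym1 (i |: A :\ j)) < mnmwgt (mesym1 A))%N.
  have : (mesym1 (i |: A :\ j) + U_(j) = mesym1 A + U_(i))%MM.
    rewrite -mesym1_swap // -addmA [(U_(i) + _)%MM]addmC addmA submK //.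
    by rewrite lep1mP mnmE jA.
  move/(congr1 mnmwgt); rewrite !mnmwgtD !mnmwgt1 => wE.
  by rewrite -(ltn_add2r j.+1) wE ltn_add2l ltnS.
rewrite LE mem_cat inE => /or3P[vL1|/eqP vu|//].
  have := leL1 _ _ vL1 (mem_head _ _).
  by rewrite /leT uE leqNgt wlt.
by rewrite vu uE ltnn in wlt.
Qed.

End SquarefreeMonomials.

(** * Homological shifts of squarefree Borel ideals *)

Section BorelIdeals.
Variables (K : fieldType) (n : nat).
Local Notation S := {mpoly K[n]}.
Implicit Types (A B t : {set 'I_n}) (G : {set 'I_n} -> Prop) (I J : S -> Prop).

Lemma mideal_ext (M M' : 'X_{1..n} -> Prop) (f : S) :
  (forall u, M u <-> M' u) -> mideal M f <-> mideal M' f.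
Proof. by move=> MM'; split=> -[s [Ms ->]]; exists s; split=> // p /Ms/MM'. Qed.

Lemma HS_ext k I J (f : S) : (forall g, I g <-> J g) -> HS k I f <-> HS k J f.
Proof.
move=> IJ; apply: mideal_ext => a.
split=> -[F [[grF resF minF] sF]]; exists F; split=> //; split=> //;
  by apply: (resolves_ext _ _).2 resF => g; rewrite IJ.
Qed.

(** The homological shift ideals of the ideal generated by a Borel stable family
    of [d]-sets: the shifts in degree [k] are the products of a generator with [k]
    of its gaps. *)
Lemma HS_borel G d I k (f : S) :
    borel_closed G -> (forall A, G A -> #|A| = d) ->
    (forall g, I g <-> mideal (mons G) g) ->
  HS k I f <-> mideal (mons (with_gaps k G)) f.
Proof.
move=> clG dG IE; have [L LG colon] := borel_linear_quotients clG dG.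
have [F [grF resF shF]] := linear_quotients K colon.
have resI : resolves F I.
  apply: (resolves_ext _ _).2 resF => g; rewrite IE midealE.
  by apply: monid_ext => m; split=> -[u /LG Lu um]; exists u.
have shFE i a : has_shift F i a <-> mons (with_gaps i G) a.
  rewrite shF; split=> [[u /LG[A GA ->] [t []]]|[_ [A [t [GA tA ti ->]]] ->]].
    rewrite gap_mesym1 => tA ti ->; exists (A :|: t); first by exists A, t.
    by rewrite mesym1U ?disjoint_sgap.
  exists (mesym1 A); first by apply/LG; exists A.
  by exists t; rewrite ?gap_mesym1 ?mesym1U ?disjoint_sgap.
have minF : min_resolution I F.
  split=> //; apply: (@linear_minimal _ _ _ d) => // i a /shFE.
  case=> _ [A [t [GA tA ti ->]]] ->.
  by rewrite mesym1U ?disjoint_sgap // mdegD !mdeg_mesym1 ti dG.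
apply: mideal_ext => a; rewrite -shFE; split=> [[F' [minF' [j ->]]]|[j ->]].
  by have [l ->] := min_resolution_shift j minF' minF; exists l.
by exists F; split=> //; exists j.
Qed.

Lemma mideal_mons G A :
  mideal (mons G) ('X_[mesym1 A] : S) <-> exists2 B, G B & B \subset A.
Proof.
rewrite midealE monidX; split=> [[_ [B GB ->]]|[B GB BA]].
  by rewrite lem_mesym1; exists B.
by exists (mesym1 B); [exists B | rewrite lem_mesym1].
Qed.

Lemma sqfree_borel_mons G :
  borel_closed G -> @sqfree_borel K n (mideal (mons G)).
Proof.
move=> clG; split.
  by exists (mons G); split=> // _ [A _ ->]; apply: sqfree_mesym1.
move=> u i j /sqfreeE ->; move: (supp u) => A {u} /mideal_mons[B GB BA].
rewrite supp_mesym1 => jA ij sq.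
have iA : i \notin A.
  apply/negP=> iA; move/forallP/(_ i): sq.
  rewrite mnmDE mnmBE !mnm1E !mnmE iA eqxx.
  by case: eqP => // ji; rewrite ji ltnn in ij.
rewrite mesym1_swap //; apply/mideal_mons.
have iB : i \notin B by apply: contra iA; apply: (subsetP BA).
have [jB|jB] := boolP (j \in B).
  by exists (i |: B :\ j); [apply: clG | rewrite setUS ?setSD].
exists B => //; apply/subsetP=> x xB; rewrite !inE (subsetP BA) // andbT.
by apply/orP; right; apply: contraNneq jB => <-.
Qed.

(** A squarefree Borel ideal is determined by its monomials, which are stable
    under multiplication by monomials. *)
Lemma sqfree_borel_monid J : sqfree_borel J ->
  (forall f, J f <-> monid (fun m => J 'X_[m]) f) /\
  (forall u v : 'X_{1..n}, J 'X_[u] -> (u <= v)%MM -> J 'X_[v]).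
Proof.
case=> -[M [_ JM]] _.
have JX u : J 'X_[u] <-> above M u by rewrite JM midealE monidX.
split=> [f|u v /JX[w Mw wu] uv].
  by rewrite JM midealE; apply: monid_ext => m; rewrite JX.
by apply/JX; exists w => //; apply: lepm_trans uv.
Qed.

Lemma sqfree_borel_closed J :
  sqfree_borel J -> borel_closed (fun A => J 'X_[mesym1 A]).
Proof.
case=> _ clJ A i j JA jA iA ij; rewrite -mesym1_swap //.
apply: clJ => //; rewrite ?supp_mesym1 ?sqfree_mesym1 //.
by rewrite mesym1_swap ?sqfree_mesym1.
Qed.

Lemma sqfree_borel_mideal J G : sqfree_borel J ->
  (forall A, G A -> J 'X_[mesym1 A]) -> forall f, mideal (mons G) f -> J f.
Proof.
move=> bJ GJ f /midealE Gf; have [JE Jup] := sqfree_borel_monid bJ.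
by apply/JE=> m /Gf[_ [A GA ->]]; apply/Jup/GJ.
Qed.

Lemma mem_B1 (us : seq 'X_{1..n}) u : u \in us -> @B1 K n us 'X_[u].
Proof. by move=> us_u J _; apply. Qed.

Section Equigenerated.
Variables (us : seq 'X_{1..n}) (d : nat).
Hypothesis us_sqfree : forall u, u \in us -> sqfree u.
Hypothesis us_deg : forall u, u \in us -> mdeg u = d.

(** The supports of the squarefree monomials of degree [d] in B_1(us). *)
Definition B1_gens : {set 'I_n} -> Prop :=
  fun A => @B1 K n us 'X_[mesym1 A] /\ #|A| = d.

Lemma B1_gens_closed : borel_closed B1_gens.
Proof.
move=> A i j [IA Ad] jA iA ij; split; last by rewrite card_swap.
by move=> J bJ usJ; apply: (sqfree_borel_closed bJ) => //; apply: IA.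
Qed.

Lemma us_mesym1 u : u \in us -> u = mesym1 (supp u) /\ #|supp u| = d.
Proof.
move=> us_u; have uE := sqfreeE (us_sqfree us_u); split=> //.
by rewrite -(us_deg us_u) [in RHS]uE mdeg_mesym1.
Qed.

(** B_1(us) is generated in degree [d]. *)
Lemma B1E (f : S) : B1 us f <-> mideal (mons B1_gens) f.
Proof.
split=> [|If J bJ usJ].
  apply; first exact: sqfree_borel_mons B1_gens_closed.
  move=> u us_u; have [uE ud] := us_mesym1 us_u; rewrite uE.
  apply/mideal_mons; exists (supp u) => //; split=> //.
  by rewrite -uE; apply: mem_B1.
apply: sqfree_borel_mideal If => // A [IA _]; exact: IA.
Qed.

(** A property of [d]-sets stable under Borel moves holds for all generators as
    soon as it holds for the Borel generators. *)
Lemma B1_gens_ind (Q : {set 'I_n} -> Prop) :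
    borel_closed Q -> (forall u, u \in us -> Q (supp u)) ->
  forall A, B1_gens A -> Q A.
Proof.
move=> clQ usQ A [IA Ad].
pose Q' A := Q A /\ #|A| = d.
have clQ' : borel_closed Q'.
  by move=> B i j [QB Bd] jB iB ij; split; [apply: clQ | rewrite card_swap].
have /mideal_mons[B [QB Bd] BA] : mideal (mons Q') ('X_[mesym1 A] : S).
  apply: IA; first exact: sqfree_borel_mons.
  move=> u us_u; have [uE ud] := us_mesym1 us_u; rewrite uE.
  by apply/mideal_mons; exists (supp u) => //; split=> //; apply: usQ.
suff <- : B = A by [].
by apply/eqP; rewrite eqEcard BA Ad Bd leqnn.
Qed.

(** The homological shift ideals of B_1(us), for [us] of constant degree: the
    Borel generators get multiplied by their [k] last gaps. *)
Lemma HS_B1 k (f : S) : HS k (B1 us) f <->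
  B1 [seq mul_max_gaps k u | u <- us & (k <= #|gap u|)%N] f.
Proof.
have dG A : B1_gens A -> #|A| = d by case.
rewrite (HS_borel k f B1_gens_closed dG B1E); split=> [Hf J bJ vsJ|].
  have clJ := sqfree_borel_closed bJ.
  apply: sqfree_borel_mideal Hf => // _ [A [t [GA tA tk ->]]].
  have: gap_full k (fun B => J 'X_[mesym1 B]) A; last exact.
  apply: (B1_gens_ind (gap_full_closed clJ) _ GA) => u us_u.
  have [uE _] := us_mesym1 us_u.
  (* Borel generators with too few gaps satisfy the property vacuously. *)
  have [ku|ku] := leqP k #|sgap (supp u)|; last first.
    by move=> s /subset_leq_card + sk; rewrite sk leqNgt ku.
  apply: gap_full_topk => //; rewrite -mul_max_gaps_mesym1 -uE.
  by apply/vsJ/map_f; rewrite mem_filter us_u [in gap u]uE gap_mesym1 ku.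
apply; first exact: sqfree_borel_mons (with_gaps_closed B1_gens_closed).
move=> _ /mapP[u + ->]; rewrite mem_filter => /andP[ku us_u].
have [uE ud] := us_mesym1 us_u.
move: ku; rewrite [in gap u]uE gap_mesym1 => ku.
rewrite [in mul_max_gaps k u]uE mul_max_gaps_mesym1; apply/mideal_mons.
exists (supp u :|: topk k (sgap (supp u))) => //.
exists (supp u), (topk k (sgap (supp u))); split; rewrite ?topk_sub ?card_topk //.
by split=> //; rewrite -uE; apply: mem_B1.
Qed.

End Equigenerated.
End BorelIdeals.

Theorem corollary4p2 (K : fieldType) (n : nat) (us : seq 'X_{1..n})
    (us_sqfree : forall u, u \in us -> sqfree u)
    (I_equigen : equigenerated (@B1 K n us))
    (us_mingen : forall u, u \in us -> mingen (@B1 K n us) u)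
    (k : nat) (k_ge1 : (1 <= k)%N) :
  (forall f : {mpoly K[n]},
     HS k (B1 us) f <->
     B1 [seq mul_max_gaps k u | u <- us & (k <= #|gap u|)%N] f) /\
  (forall f : {mpoly K[n]}, HS 1 (HS k (B1 us)) f <-> HS k.+1 (B1 us) f).
Proof.
have [d us_min] := I_equigen.
have us_deg u (us_u : u \in us) : mdeg u = d := us_min u (us_mingen u us_u).
split=> f; first exact: HS_B1 us_sqfree us_deg k f.
pose vs := [seq mul_max_gaps k u | u <- us & (k <= #|gap u|)%N].
have HSk (g : {mpoly K[n]}) : HS k (B1 us) g <-> B1 vs g.
  exact: HS_B1 us_sqfree us_deg k g.
rewrite (HS_ext 1 f HSk) (HS_B1 us_sqfree us_deg).
have vsP v : v \in vs ->
    exists2 u, u \in us & (k <= #|gap u|)%N /\ v = mul_max_gaps k u.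
  by case/mapP=> u; rewrite mem_filter => /andP[ku us_u] ->; exists u.
have vs_sqfree v : v \in vs -> sqfree v.
  case/vsP=> u us_u [_ ->]; rewrite (sqfreeE (us_sqfree u us_u)).
  by rewrite mul_max_gaps_mesym1 sqfree_mesym1.
have vs_deg v : v \in vs -> mdeg v = (d + k)%N.
  case/vsP=> u us_u [ku ->]; rewrite -(us_deg u us_u).
  move: ku; rewrite (sqfreeE (us_sqfree u us_u)) mul_max_gaps_mesym1 gap_mesym1.
  move=> ku.
  by rewrite mesym1U ?disjoint_sgap ?topk_sub // mdegD !mdeg_mesym1 card_topk.
rewrite (HS_B1 vs_sqfree vs_deg).
suff -> : [seq mul_max_gaps 1 v | v <- vs & (1 <= #|gap v|)%N] =
          [seq mul_max_gaps k.+1 u | u <- us & (k < #|gap u|)%N] by [].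
rewrite /vs filter_map -map_comp -filter_predI.
have usE u : u \in us -> u = mesym1 (supp u) by move/us_sqfree/sqfreeE.
have -> : [seq u <- us | (k < #|gap u|)%N] =
  [seq u <- us | predI (preim (mul_max_gaps k) (fun v => (1 <= #|gap v|)%N))
                       (fun u => (k <= #|gap u|)%N) u].
  apply: eq_in_filter => u /usE->; rewrite /= mul_max_gaps_mesym1 !gap_mesym1.
  have [kA|Ak] := leqP k #|sgap (supp u)|; last first.
    by rewrite andbF; apply/negbTE; rewrite -leqNgt ltnW.
  rewrite andbT sgapU ?topk_sub // cardsD (setIidPr (topk_sub _ _)).
  by rewrite card_topk // subn_gt0.
apply/eq_in_map=> u; rewrite mem_filter => /andP[/andP[_ /= ku] /usE uE].
by rewrite uE gap_mesym1 in ku *; rewrite mul_max_gaps_add1.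
Qed.
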